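(* \textsc{Multipacking} parameterized by the vertex cover number $c$ of the input digraph can be solved in time $2^{2^{O(c)}}n^{O(1)}$ on digraphs of order $n$.
   Context: Digraphs are finite and assumed weakly connected. For vertices $u,v$, $d(u,v)$ is the length of a shortest directed path from $u$ to $v$ ($\infty$ if none); $B^+_r(v)=\{u: d(v,u)\le r\}$. A multipacking of $D$ is a set $S\subseteq V(D)$ such that for every vertex $v$ and every integer $r\ge 1$, $|B^+_r(v)\cap S|\le r$. \textsc{Multipacking}: given $D$ and $k$, decide whether $D$ has a multipacking of size at least $k$. The vertex cover number of a digraph is the minimum size of a set of vertices intersecting every arc. *)

(* Defs.v *)
From HB Require Import structures.
From mathcomp Require Import all_boot.

Set Implicit Arguments.
Unset Strict Implicit.
Unset Printing Implicit Defensive.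

(* Loops and pairs of opposite arcs are allowed. *)
Record digraph := Digraph { dorder : nat; darc : rel 'I_dorder }.

Section Digraphs.

Variable D : digraph.
Local Notation V := 'I_(dorder D).
Implicit Types (u v : V) (S X : {set V}) (m r : nat).

(* The null digraph is not regarded as weakly connected. *)
Definition weakly_connected : Prop :=
  0 < dorder D /\
  forall u v, connect (fun x y => @darc D x y || @darc D y x) u v.

Definition has_dipath u v m : bool :=
  [exists p : m.-tuple V,
    [&& path (@darc D) u p, last u p == v & uniq (u :: p)]].

Lemma connect_has_dipath u v :
  connect (@darc D) u v -> exists m, has_dipath u v m.
Proof.
move=> /connectP[p arc_p ->]; case/shortenP: arc_p => q arc_q uniq_q _.
by exists (size q); apply/existsP; exists (in_tuple q); rewrite arc_q eqxx.
Qed.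

(* [None] stands for an infinite distance. *)
Definition dist u v : option nat :=
  match @idP (connect (@darc D) u v) with
  | ReflectT uv => Some (ex_minn (connect_has_dipath uv))
  | ReflectF _ => None
  end.

Definition out_ball v r : {set V} :=
  [set u | if dist v u is Some m then m <= r else false].

Definition multipacking S : Prop :=
  forall v r, 1 <= r -> #|out_ball v r :&: S| <= r.

Definition vertex_cover X : bool :=
  [forall u, forall v, @darc D u v ==> (u \in X) || (v \in X)].

Definition vertex_cover_number : nat :=
  #|[arg min_(X < [set: V] | vertex_cover X) #|X|]|.

(* [setT] is a vertex cover, so that the minimum above is a genuine one. *)
Lemma vertex_cover_setT : vertex_cover [set: V].
Proof. by apply/forallP=> u; apply/forallP=> v; rewrite inE implybT. Qed.

End Digraphs.

Definition Multipacking (D : digraph) (k : nat) : Prop :=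
  exists S : {set 'I_(dorder D)}, multipacking S /\ k <= #|S|.

(* The model of computation is the unit-cost random-access machine with        *)
(* addition and truncated subtraction as only arithmetic operations (no unit-  *)
(* cost multiplication, hence polynomially equivalent to Turing machines), and *)
(* with structured control.  A machine has scalar registers and unbounded      *)
(* arrays of natural numbers; a program mentions finitely many of them, so     *)
(* that they can be interleaved into a single memory at the price of a         *)
(* constant factor.                                                            *)
Inductive expr :=
  | Const of nat
  | Reg of nat
  | Fetch of nat & expr (* array, index *)
  | Add of expr & expr
  | Sub of expr & expr.

Inductive program :=
  | Skip
  | Assign of nat & expr
  | Store of nat & expr & expr (* array, index, value *)
  | Seq of program & program
  | If of expr & program & program
  | While of expr & program.

Record state := State { reg : nat -> nat; arr : nat -> nat -> nat }.

Definition set_reg (s : state) (x v : nat) : state :=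
  State (fun y => if y == x then v else reg s y) (arr s).

Definition set_arr (s : state) (a i v : nat) : state :=
  State (reg s) (fun b j => if (b == a) && (j == i) then v else arr s b j).

Fixpoint eval (s : state) (e : expr) : nat :=
  match e with
  | Const m => m
  | Reg x => reg s x
  | Fetch a e1 => arr s a (eval s e1)
  | Add e1 e2 => eval s e1 + eval s e2
  | Sub e1 e2 => eval s e1 - eval s e2
  end.

Fixpoint cost (e : expr) : nat :=
  match e with
  | Const _ | Reg _ => 1
  | Fetch _ e1 => (cost e1).+1
  | Add e1 e2 | Sub e1 e2 => (cost e1 + cost e2).+1
  end.

(* [exec p s s' t]: started in [s], [p] halts in [s'] after [t] steps.  A test *)
(* succeeds when its value is nonzero.                                         *)
Inductive exec : program -> state -> state -> nat -> Prop :=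
  | exec_Skip s : exec Skip s s 1
  | exec_Assign s x e :
      exec (Assign x e) s (set_reg s x (eval s e)) (cost e).+1
  | exec_Store s a e1 e2 :
      exec (Store a e1 e2) s (set_arr s a (eval s e1) (eval s e2))
        (cost e1 + cost e2).+1
  | exec_Seq p1 p2 s s1 s2 t1 t2 :
      exec p1 s s1 t1 -> exec p2 s1 s2 t2 -> exec (Seq p1 p2) s s2 (t1 + t2)
  | exec_IfT e p1 p2 s s' t :
      eval s e != 0 -> exec p1 s s' t ->
      exec (If e p1 p2) s s' ((cost e).+1 + t)
  | exec_IfF e p1 p2 s s' t :
      eval s e = 0 -> exec p2 s s' t ->
      exec (If e p1 p2) s s' ((cost e).+1 + t)
  | exec_WhileT e p s s1 s2 t1 t2 :
      eval s e != 0 -> exec p s s1 t1 -> exec (While e p) s1 s2 t2 ->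
      exec (While e p) s s2 ((cost e).+1 + t1 + t2)
  | exec_WhileF e p s :
      eval s e = 0 -> exec (While e p) s s (cost e).+1.

(* Input: the order n in register 0, k in register 1, and the n x n adjacency  *)
(* matrix, row by row, in array 0; everything else is 0.  The vertex cover     *)
(* number is not part of the input.                                            *)
Definition adjacency_cell (D : digraph) (m : nat) : bool :=
  [exists i : 'I_(dorder D), exists j : 'I_(dorder D),
    (m == i * dorder D + j) && darc i j].

Definition initial_state (D : digraph) (k : nat) : state :=
  State
    (fun x => if x == 0 then dorder D else if x == 1 then k else 0)
    (fun a m => if a == 0 then adjacency_cell D m : nat else 0).

(* The answer is left in register 0: 1 for yes, 0 for no. *)
Definition solves_Multipacking_in_time (p : program) (T : digraph -> nat) :=
  forall (D : digraph) (k : nat), weakly_connected D ->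
  exists (s : state) (t : nat),
    [/\ exec p (initial_state D k) s t, t <= T D,
        Multipacking D k -> reg s 0 = 1 &
        ~ Multipacking D k -> reg s 0 = 0].

Definition bigO (f g : nat -> nat) : Prop :=
  exists a N : nat, forall m, N <= m -> f m <= a * g m.

(* Main.v *)
Require Import Defs.
From mathcomp Require Import all_boot all_fingroup zify.

(* Group the vertices into classes of false twins.  Two twins with a common    *)
(* in-neighbour are never both selected (radius 1), and exchanging twins is an *)
(* automorphism, so a non-source may be assumed to be selected only if it is   *)
(* the least vertex of its class.  A source lies in no ball but its own, so    *)
(* with one source all its twins may be selected.  Hence some maximum          *)
(* multipacking is determined by the set of selected class representatives.    *)
(* The vertices outside a cover X are classified by their two neighbourhoods   *)
(* in X, so there are at most c + 4 ^ c classes, and a double exponential      *)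
(* number of candidates, each checked in polynomial time; the cover itself is  *)
(* never computed.                                                             *)

Set Implicit Arguments.
Unset Strict Implicit.
Unset Printing Implicit Defensive.

(** * Running time of programs with bounded loops *)

(** Let m be the number of twin-class representatives. By [canonical_multipacking] it is enough to
    search among canonical sets. Such a set is determined by the representatives it contains, hence
    by the m binary digits of its [code], so trying N = 2 ^ m numbers settles the question.
    [card_repr_twin] bounds m by 2 ^ (2c+1), and this is where the vertex cover number enters.

    Correctness and running time are treated separately. Every loop of the program counts up to a
    register that is fixed during the loop, so the shape of the program alone bounds any terminating
    run by a polynomial in the largest loop bound ([exec_time_bound], [time_bound_poly]). The
    correctness lemmas, stated with [runs] and [computes], therefore never count steps. The loop
    bounds are the order n and N, and a polynomial in N * n has the required form by
    [leq_double_exp]. *)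

Fixpoint written_regs (p : program) : seq nat :=
  match p with
  | Skip | Store _ _ _ => [::]
  | Assign x _ => [:: x]
  | Seq p1 p2 | If _ p1 p2 => written_regs p1 ++ written_regs p2
  | While _ p1 => written_regs p1
  end.

Fixpoint written_arrs (p : program) : seq nat :=
  match p with
  | Skip | Assign _ _ => [::]
  | Store a _ _ => [:: a]
  | Seq p1 p2 | If _ p1 p2 => written_arrs p1 ++ written_arrs p2
  | While _ p1 => written_arrs p1
  end.

Definition frame (p : program) (s s' : state) : Prop :=
  (forall x, x \notin written_regs p -> reg s' x = reg s x) /\
  (forall a, a \notin written_arrs p -> arr s' a = arr s a).

Lemma exec_frame p s s' t : exec p s s' t -> frame p s s'.
Proof.
elim=> {p s s' t} //=.
- move=> s x e; split=> // y; rewrite inE => /negbTE /= y_x.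
  by rewrite y_x.
- move=> s a e1 e2; split=> // b; rewrite inE => /negbTE /= b_a.
  by rewrite b_a.
- move=> p1 p2 s s1 s2 t1 t2 _ [r1 a1] _ [r2 a2].
  split=> x; rewrite mem_cat negb_or => /andP[x1 x2].
    by rewrite r2 ?r1.
  by rewrite a2 ?a1.
- move=> e p1 p2 s s' t _ _ [r1 a1].
  split=> x; rewrite mem_cat negb_or => /andP[x1 x2]; [exact: r1|exact: a1].
- move=> e p1 p2 s s' t _ _ [r1 a1].
  split=> x; rewrite mem_cat negb_or => /andP[x1 x2]; [exact: r1|exact: a1].
- move=> e p s s1 s2 t1 t2 _ _ [r1 a1] _ [r2 a2].
  by split=> x xp; [rewrite r2 ?r1|rewrite a2 ?a1].
Qed.

Definition For (x y : nat) (p : program) : program :=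
  Seq (Assign x (Const 0))
      (While (Defs.Sub (Reg y) (Reg x)) (Seq p (Assign x (Add (Reg x) (Const 1))))).

(** Only the [While] part of [For] is recognized, without its initialization: a counter that starts
    above 0 can only shorten the loop. *)
Definition bounded_loops (ys : seq nat) : program -> Prop :=
  fix bounded p := match p with
  | Skip | Assign _ _ | Store _ _ _ => True
  | Seq p1 p2 | If _ p1 p2 => bounded p1 /\ bounded p2
  | While e p1 => exists x y q,
      [/\ e = Defs.Sub (Reg y) (Reg x),
          p1 = Seq q (Assign x (Add (Reg x) (Const 1))),
          y \in ys, x \notin written_regs q & bounded p1]
  end.

Fixpoint time_bound (M : nat) (p : program) : nat :=
  match p with
  | Skip => 1
  | Assign _ e => (cost e).+1
  | Store _ e1 e2 => (cost e1 + cost e2).+1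
  | Seq p1 p2 => time_bound M p1 + time_bound M p2
  | If e p1 p2 => (cost e).+1 + time_bound M p1 + time_bound M p2
  | While e p1 => M * ((cost e).+1 + time_bound M p1) + (cost e).+1
  end.

Lemma time_bound_poly p :
  exists a j, forall M, 0 < M -> time_bound M p <= a * M ^ j.
Proof.
have expM M j1 j2 : 0 < M -> j1 <= j2 -> M ^ j1 <= M ^ j2.
  by move=> M0 ?; apply: leq_pexp2l.
elim: p => [|x e|b e1 e2|p1 [a1 [j1 h1]] p2 [a2 [j2 h2]]
           |e p1 [a1 [j1 h1]] p2 [a2 [j2 h2]]|e p [a [j h]]] /=.
- by exists 1, 0.
- by exists (cost e).+1, 0 => M _; rewrite muln1.
- by exists (cost e1 + cost e2).+1, 0 => M _; rewrite muln1.
- exists (a1 + a2), (j1 + j2) => M M0.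
  rewrite mulnDl leq_add //.
    by apply: leq_trans (h1 M M0) _; rewrite leq_mul2l expM ?orbT ?leq_addr.
  by apply: leq_trans (h2 M M0) _; rewrite leq_mul2l expM ?orbT ?leq_addl.
- exists ((cost e).+1 + a1 + a2), (j1 + j2) => M M0.
  rewrite !mulnDl !leq_add //.
  + by rewrite leq_pmulr // expn_gt0 M0.
  + by apply: leq_trans (h1 M M0) _; rewrite leq_mul2l expM ?orbT ?leq_addr.
  + by apply: leq_trans (h2 M M0) _; rewrite leq_mul2l expM ?orbT ?leq_addl.
- exists ((cost e).+1 + a + (cost e).+1), j.+1 => M M0.
  rewrite mulnDl leq_add ?leq_pmulr ?expn_gt0 ?M0 //.
  rewrite expnS mulnCA leq_mul2l mulnDl leq_add ?orbT //; last exact: h.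
  by rewrite leq_pmulr // expn_gt0 M0.
Qed.

(** Each iteration pays 4 for the test and 4 for the increment besides the body; the last 4 is the
    failing test. The invariant [P] keeps the bound register below [M]. *)
Lemma exec_for_time x y q M T (P : state -> Prop) s s' t :
  exec (While (Defs.Sub (Reg y) (Reg x)) (Seq q (Assign x (Add (Reg x) (Const 1)))))
    s s' t ->
  x \notin written_regs q -> x != y ->
  (forall s1, P s1 -> reg s1 y <= M) ->
  (forall s1 s2 t, exec q s1 s2 t -> P s1 -> P (set_reg s2 x (reg s1 x).+1)) ->
  (forall s1 s2 t, exec q s1 s2 t -> P s1 -> t <= T) ->
  P s -> t <= (M - reg s x) * (T + 8) + 4.
Proof.
move pE: (While _ _) => p ex.
move=> xq xy PM PP PT.
elim: ex pE => [||||||e p1 s0 s1 s2 t1 t2 s_y ex1 _ ex2 IH|e p1 s0 s_y] //.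
all: move=> [? ?] Ps; subst e p1.
  move: ex1 => /=; inversion_clear 1.
  move: H0 IH; inversion_clear 1 => /(_ erefl) /=.
  have /= xs3 := (exec_frame H).1 _ xq.
  rewrite xs3 addn1.
  move=> /(_ (PP _ _ _ H Ps)); rewrite eqxx.
  have := PM _ Ps; move: s_y; rewrite /= => s_y sM t2le.
  have tle := PT _ _ _ H Ps.
  have -> : M - reg s0 x = (M - (reg s0 x).+1).+1 by lia.
  by rewrite mulSn; lia.
exact: leq_addl.
Qed.

Lemma exec_time_bound ys M p s s' t :
  exec p s s' t -> bounded_loops ys p ->
  all [predC written_regs p] ys -> all [pred y | reg s y <= M] ys ->
  t <= time_bound M p.
Proof.
elim: p s s' t => [|x e|b e1 e2|p1 IH1 p2 IH2|e p1 IH1 p2 IH2|e p IH] s s' t /=.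
- by inversion_clear 1.
- by inversion_clear 1.
- by inversion_clear 1.
- inversion_clear 1 => -[b1 b2] yp sM.
  have [yp1 yp2] : all [predC written_regs p1] ys /\
                   all [predC written_regs p2] ys.
    by split; apply: sub_all yp => y /=; rewrite mem_cat negb_or => /andP[].
  apply: leq_add; first exact: (IH1 _ _ _ H0).
  apply: (IH2 _ _ _ H1) => //; apply/allP => y yys /=.
  by rewrite ((exec_frame H0).1 _ (allP yp1 _ yys)); exact: (allP sM).
- move=> ex [b1 b2] yp sM.
  have [yp1 yp2] : all [predC written_regs p1] ys /\
                   all [predC written_regs p2] ys.
    by split; apply: sub_all yp => y /=; rewrite mem_cat negb_or => /andP[].
  inversion_clear ex.
    by have := IH1 _ _ _ H0 b1 yp1 sM; lia.
  by have := IH2 _ _ _ H0 b2 yp2 sM; lia.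
- move=> ex [x [y [q [? pE yys xq bp]]]] yp sM; subst e.
  pose P s := all [pred y | reg s y <= M] ys : Prop.
  have yp' z : z \in ys -> z != x /\ z \notin written_regs q.
    move/(allP yp) => /=; rewrite pE /= mem_cat !inE negb_or => /andP[].
    by move=> ? /negbTE->.
  have [yx yq] := yp' _ yys.
  have step s1 s2 t1 : exec q s1 s2 t1 ->
      exec p s1 (set_reg s2 x (reg s1 x).+1) (t1 + 4).
    move=> ex1; rewrite pE; apply: (exec_Seq ex1).
    have <- : eval s2 (Add (Reg x) (Const 1)) = (reg s1 x).+1.
      by rewrite /= addn1 ((exec_frame ex1).1 _ xq).
    exact: exec_Assign.
  rewrite pE in ex.
  have xy : x != y by rewrite eq_sym.
  (* The induction hypothesis speaks of the whole loop body [p], that is, [q] followed by the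
     increment of cost 4; [step] turns a run of [q] into one of [p]. *)
  apply: leq_trans (exec_for_time (T := time_bound M p - 4) (P := P)
                      ex xq xy _ _ _ sM) _.
  + by move=> s1 /allP Ps1; apply: Ps1 yys.
  + move=> s1 s2 t1 ex1 /allP Ps1; apply/allP => z zys /=.
    have [/negbTE-> zq] := yp' _ zys.
    by rewrite ((exec_frame ex1).1 _ zq); apply: Ps1.
  + move=> s1 s2 t1 /step ex1 Ps1.
    by have := IH _ _ _ ex1 bp yp Ps1; lia.
  + have : 4 <= time_bound M p by rewrite pE /=; lia.
    rewrite /=; nia.
Qed.
(** * Program logic *)

(** Total correctness with the step count forgotten, since the time is recovered from the shape of
    the program. *)
Definition runs (p : program) (s : state) (Q : state -> Prop) : Prop :=
  exists s' t, exec p s s' t /\ Q s'.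

Lemma runs_conseq p s (Q Q' : state -> Prop) :
  runs p s Q -> (forall s', frame p s s' -> Q s' -> Q' s') -> runs p s Q'.
Proof.
move=> [s' [t [ex Qs]]] QQ; exists s', t; split=> //.
exact: QQ (exec_frame ex) _.
Qed.

Lemma runs_skip s (Q : state -> Prop) : Q s -> runs Skip s Q.
Proof. by exists s, 1; split=> //; apply: exec_Skip. Qed.

Lemma runs_assign x e s (Q : state -> Prop) :
  Q (set_reg s x (eval s e)) -> runs (Assign x e) s Q.
Proof. by move=> Qs; eexists _, _; split; first exact: exec_Assign. Qed.

Lemma runs_store a e1 e2 s (Q : state -> Prop) :
  Q (set_arr s a (eval s e1) (eval s e2)) -> runs (Store a e1 e2) s Q.
Proof. by move=> Qs; eexists _, _; split; first exact: exec_Store. Qed.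

Lemma runs_seq p1 p2 s (Q : state -> Prop) :
  runs p1 s (fun s1 => runs p2 s1 Q) -> runs (Seq p1 p2) s Q.
Proof.
move=> [s1 [t1 [ex1 [s2 [t2 [ex2 Qs]]]]]].
by exists s2, (t1 + t2); split=> //; apply: exec_Seq ex1 ex2.
Qed.

Lemma runs_if e p1 p2 s (Q : state -> Prop) :
  (eval s e != 0 -> runs p1 s Q) -> (eval s e = 0 -> runs p2 s Q) ->
  runs (If e p1 p2) s Q.
Proof.
have [e0 _|e0 + _] := eqVneq (eval s e) 0.
  move=> /(_ e0) [s' [t [ex Qs]]].
  by exists s', ((cost e).+1 + t); split=> //; apply: exec_IfF.
move=> /(_ isT) [s' [t [ex Qs]]].
by exists s', ((cost e).+1 + t); split=> //; apply: exec_IfT.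
Qed.

Lemma runs_for x y p s (I : nat -> state -> Prop) :
  x != y -> I 0 (set_reg s x 0) ->
  (forall i s1, i < reg s y -> reg s1 x = i -> reg s1 y = reg s y -> I i s1 ->
    runs p s1 (fun s2 => [/\ reg s2 x = i, reg s2 y = reg s y &
                             I i.+1 (set_reg s2 x i.+1)])) ->
  runs (For x y p) s (I (reg s y)).
Proof.
move=> xy I0 IS; apply: runs_seq; apply: runs_assign => /=.
set N := reg s y; set s0 := set_reg s x 0.
have s0x : reg s0 x = 0 by rewrite /= eqxx.
have s0y : reg s0 y = N by rewrite /= eq_sym (negbTE xy).
suff H m i s1 : N - i = m -> i <= N -> I i s1 -> reg s1 x = i -> reg s1 y = N ->
    runs (While (Defs.Sub (Reg y) (Reg x))
      (Seq p (Assign x (Add (Reg x) (Const 1))))) s1 (I N).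
  by apply: (H N 0); rewrite ?subn0.
elim: m i s1 {s0 s0x s0y I0} => [|m IH] i s0 Ni iN Ii s0x s0y.
  have {Ni}Ni : i = N by lia.
  rewrite -Ni; eexists s0, _; split=> //; apply: exec_WhileF.
  by rewrite /= s0x s0y Ni subnn.
have [|s1 [t1 [ex1 [s1x s1y Is1]]]] := IS i s0 _ s0x s0y Ii; first by lia.
have [||||s2 [t2 [ex2 Qs2]]] := IH i.+1 (set_reg s1 x i.+1) _ _ Is1; last first.
  eexists s2, _; split=> //; apply: exec_WhileT; last exact: ex2.
    by rewrite /= s0x s0y Ni.
  apply: (exec_Seq ex1).
  have -> : i.+1 = eval s1 (Add (Reg x) (Const 1)) by rewrite /= s1x addn1.
  exact: exec_Assign.
- by rewrite /= eq_sym (negbTE xy).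
- by rewrite /= eqxx.
- by lia.
- by lia.
Qed.

Lemma runs_for_frame x y p s (I : nat -> state -> Prop) :
  x != y -> x \notin written_regs p -> y \notin written_regs p ->
  I 0 (set_reg s x 0) ->
  (forall i s1, i < reg s y -> reg s1 x = i -> frame (For x y p) s s1 ->
    I i s1 -> runs p s1 (fun s2 => I i.+1 (set_reg s2 x i.+1))) ->
  runs (For x y p) s (I (reg s y)).
Proof.
move=> xy xp yp I0 IS.
suff: runs (For x y p) s (fun s2 => frame (For x y p) s s2 /\ I (reg s y) s2).
  by move/runs_conseq; apply=> s' _ [].
have fr i s' : frame p s s' -> frame (For x y p) s (set_reg s' x i).
  move=> [r a]; split=> z /=; last by rewrite cats0 => /a.
  by rewrite inE mem_cat !negb_or => /and3P[/negbTE-> /r].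
have fr1 s1 s2 i : frame (For x y p) s s1 -> frame p s1 s2 ->
    frame (For x y p) s (set_reg s2 x i).
  move=> fr1 [r a]; split=> z zp; last first.
    by rewrite a ?fr1.2 //; move: zp; rewrite /= cats0.
  have := zp; rewrite /= inE mem_cat !negb_or => /and3P[/negbTE-> zq _].
  by rewrite r ?fr1.1.
pose I' i s' := frame (For x y p) s s' /\ I i s'.
apply: (@runs_for x y p s I') => //.
  by split=> //; apply: fr; split.
move=> i s1 iN s1x s1y [frs1 Is1].
apply: runs_conseq (IS i s1 iN s1x frs1 Is1) _ => s2 frs2 Is2.
by split; [rewrite frs2.1|rewrite frs2.1|split=> //; apply: fr1 frs2].
Qed.

(* Programs that leave a value in register [d], using no other registers than  *)
(* [d], [d.+1], ... and no array.                                              *)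
Definition extends (d : nat) (s s' : state) : Prop :=
  arr s' = arr s /\ forall x, x < d -> reg s' x = reg s x.

Definition computes (d : nat) (p : program) (s : state) (R : nat -> Prop) :=
  runs p s (fun s' => extends d s s' /\ R (reg s' d)).

Definition is_true_iff (b : bool) (m : nat) : Prop := (m != 0) = b.

Lemma computes_conseq d p s (R R' : nat -> Prop) :
  computes d p s R -> (forall m, R m -> R' m) -> computes d p s R'.
Proof. by move=> h RR; apply: runs_conseq h _ => s' _ [? /RR]. Qed.

Lemma extends_trans d s1 s2 s3 :
  extends d s1 s2 -> extends d s2 s3 -> extends d s1 s3.
Proof. by move=> [a1 r1] [a2 r2]; split=> [|x xd]; rewrite ?a2 ?r2 ?r1. Qed.

Lemma extendsW d d' s1 s2 : d <= d' -> extends d' s1 s2 -> extends d s1 s2.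
Proof. by move=> dd [a r]; split=> // x xd; apply: r; apply: leq_trans dd. Qed.

Lemma extends_set d x v s : d <= x -> extends d s (set_reg s x v).
Proof. by move=> dx; split=> //= y yd; rewrite ltn_eqF //; apply: leq_trans dx. Qed.

Lemma computes_assign d e s (R : nat -> Prop) :
  R (eval s e) -> computes d (Assign d e) s R.
Proof.
move=> Re; apply: runs_assign; split; first exact: extends_set.
by rewrite /= eqxx.
Qed.

Definition Apply (d : nat) (p : program) (e : expr) := Seq p (Assign d e).

Lemma computes_apply d p e s (R R' : nat -> Prop) :
  computes d p s R ->
  (forall s', extends d s s' -> R (reg s' d) -> R' (eval s' e)) ->
  computes d (Apply d p e) s R'.
Proof.
move=> h RR; apply: runs_seq; apply: runs_conseq h _ => s1 _ [ext1 R1].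
apply: runs_assign; split; last by rewrite /= eqxx; apply: RR.
by apply: extends_trans ext1 _; apply: extends_set.
Qed.

Definition IfThenElse (d : nat) (p q r : program) := Seq p (If (Reg d) q r).

Lemma computes_if d p q r s (R Q : nat -> Prop) :
  computes d p s R ->
  (forall m s', extends d s s' -> R m -> m != 0 -> computes d q s' Q) ->
  (forall s', extends d s s' -> R 0 -> computes d r s' Q) ->
  computes d (IfThenElse d p q r) s Q.
Proof.
move=> h hq hr; apply: runs_seq; apply: runs_conseq h _ => s1 _ [ext1 R1].
apply: runs_if => /= s1d.
  apply: runs_conseq (hq _ _ ext1 R1 s1d) _ => s2 _ [ext2 Q2].
  by split=> //; apply: extends_trans ext2.
rewrite s1d in R1; apply: runs_conseq (hr _ ext1 R1) _ => s2 _ [ext2 Q2].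
by split=> //; apply: extends_trans ext2.
Qed.

Definition Not (d : nat) (p : program) :=
  IfThenElse d p (Assign d (Const 0)) (Assign d (Const 1)).
Definition And (d : nat) (p q : program) :=
  IfThenElse d p q (Assign d (Const 0)).
Definition Or (d : nat) (p q : program) :=
  IfThenElse d p (Assign d (Const 1)) q.

Lemma computes_not d p s b :
  computes d p s (is_true_iff b) -> computes d (Not d p) s (is_true_iff (~~ b)).
Proof.
move=> h; apply: (computes_if h) => [m s' _ <-|s' _ <-].
  by move=> m0; apply: computes_assign; rewrite /is_true_iff m0.
by apply: computes_assign; rewrite /is_true_iff.
Qed.

Lemma computes_and d p q s b c :
  computes d p s (is_true_iff b) ->
  (b -> forall s', extends d s s' -> computes d q s' (is_true_iff c)) ->
  computes d (And d p q) s (is_true_iff (b && c)).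
Proof.
move=> h hq; apply: (computes_if h) => [m s' ext1 mb m0|s' _ <-].
  have b1 : b by rewrite -mb.
  by rewrite b1; apply: hq.
by apply: computes_assign; rewrite /is_true_iff.
Qed.

Lemma computes_or d p q s b c :
  computes d p s (is_true_iff b) ->
  (forall s', extends d s s' -> computes d q s' (is_true_iff c)) ->
  computes d (Or d p q) s (is_true_iff (b || c)).
Proof.
move=> h hq; apply: (computes_if h) => [m s' ext1 <- m0|s' ext1 <-].
  by apply: computes_assign; rewrite /is_true_iff m0.
exact: hq.
Qed.

(* The body of the loop finds its index in register [d.+1] and leaves its      *)
(* value in register [d.+2].                                                   *)
Definition Sum (d : nat) (p : program) : program :=
  Seq (Assign d (Const 0))
      (For d.+1 0 (Seq p (Assign d (Add (Reg d) (Reg d.+2))))).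

(** The loop value is described by a relation [R] because a test is known only up to being nonzero;
    [J i] is the invariant of the i-th partial sum. *)
Lemma computes_fold d p s n (R : 'I_n -> nat -> Prop) (J : nat -> nat -> Prop) :
  0 < d -> reg s 0 = n -> J 0 0 ->
  (forall (i : 'I_n) s', extends d s s' -> reg s' d.+1 = i ->
     computes d.+2 p s' (R i)) ->
  (forall (i : 'I_n) a b, J i a -> R i b -> J i.+1 (a + b)) ->
  computes d (Sum d p) s (J n).
Proof.
move=> d0 sn J0 hp JS; apply: runs_seq; apply: runs_assign => /=.
pose I i s1 := extends d s s1 /\ J i (reg s1 d).
suff: runs (For d.+1 0 (Seq p (Assign d (Add (Reg d) (Reg d.+2)))))
    (set_reg s d 0) (I (reg (set_reg s d 0) 0)).
  by rewrite /= (ltn_eqF d0) sn.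
apply: runs_for => //.
  split; first by apply: extends_trans (extends_set _ _ _) (extends_set _ _ _).
  by rewrite /= (ltn_eqF (ltnSn d)) eqxx.
rewrite /= (ltn_eqF d0) sn => i s1 iN s1i s1n [ext1 J1].
have := hp (Ordinal iN) s1 ext1 s1i.
move/(@runs_conseq)=> h; apply: runs_seq; apply: h => s2 _ [ext2 R2].
apply: runs_assign => /=.
rewrite gtn_eqF // (ltn_eqF d0) !(ext2.2 d.+1, ext2.2 d, ext2.2 0) //.
split=> //; split.
  apply: extends_trans ext1 _; apply: extends_trans (extends_set _ _ _) => //.
  apply: extends_trans (extends_set _ _ _) => //.
  by apply: extendsW ext2; apply: leqW (leqnSn d).
rewrite /= (ltn_eqF (ltnSn d)) eqxx.
exact: (JS (Ordinal iN)).
Qed.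

Lemma computes_sum d p s n (F : 'I_n -> nat) :
  0 < d -> reg s 0 = n ->
  (forall (i : 'I_n) s', extends d s s' -> reg s' d.+1 = i ->
     computes d.+2 p s' (eq (F i))) ->
  computes d (Sum d p) s (eq (\sum_i F i)).
Proof.
move=> d0 sn hp.
pose J i a := \sum_(j < n | j < i) F j = a.
apply: computes_conseq (@computes_fold d p s n _ J d0 sn _ hp _) _.
- by rewrite /J big_pred0.
- move=> i a b <- <-; rewrite /J (bigD1 i) //= addnC; congr (_ + _).
  by apply: eq_bigl => j; rewrite ltnS [RHS]ltn_neqAle andbC.
- by move=> m <-; apply: eq_bigl => j; rewrite ltn_ord.
Qed.

(** A sum of natural numbers is nonzero exactly when some term is, so [Sum] also serves as an
    existential quantifier. *)
Lemma computes_exists d p s n (P : 'I_n -> bool) :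
  0 < d -> reg s 0 = n ->
  (forall (i : 'I_n) s', extends d s s' -> reg s' d.+1 = i ->
     computes d.+2 p s' (is_true_iff (P i))) ->
  computes d (Sum d p) s (is_true_iff [exists i, P i]).
Proof.
move=> d0 sn hp.
pose J i := is_true_iff [exists j : 'I_n, (j < i) && P j].
apply: computes_conseq (@computes_fold d p s n _ J d0 sn _ hp _) _.
- by apply/esym/existsP => -[].
- move=> i a b Ja Rb; rewrite /J /is_true_iff addn_eq0 negb_and Ja Rb.
  apply/orP/existsP=> [[/existsP[j /andP[ji Pj]]|Pi]|[j /andP[]]].
  + by exists j; rewrite Pj ltnW.
  + by exists i; rewrite Pi ltnSn.
  rewrite ltnS leq_eqVlt => /orP[/eqP/val_inj->|ji] Pj; first by right.
  by left; apply/existsP; exists j; rewrite ji.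
- by rewrite /J /is_true_iff => m ->; apply: eq_existsb => j; rewrite ltn_ord.
Qed.

(** * Twins and canonical multipackings *)

Section Balls.

Variable D : digraph.
Local Notation V := 'I_(dorder D).
Implicit Types (u v w x y : V) (S : {set V}) (r : nat).

Fixpoint ball r v : {set V} :=
  if r is r'.+1
  then [set u | (u \in ball r' v) || [exists w, (w \in ball r' v) && darc w u]]
  else [set v].

Lemma ballP r v u :
  reflect (exists p, [/\ path (@darc D) v p, last v p = u & size p <= r])
          (u \in ball r v).
Proof.
apply: (iffP idP) => [|[p [pp pl sp]]].
  elim: r u => [|r IH] u /=; rewrite inE; first by move/eqP->; exists [::].
  case/orP=> [/IH[p [pp pl sp]]|]; first by exists p; split=> //; apply: leqW.
  case/existsP=> w /andP[/IH[p [pp pl sp]] wu].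
  by exists (rcons p u); rewrite rcons_path last_rcons pl size_rcons pp wu.
elim: r p u pp pl sp => [|r IH] p u; first by case: p => //= _ -> _; rewrite inE.
case/lastP: p => [|p z] /=.
  by move=> _ uv _; rewrite inE (IH [::]).
rewrite rcons_path last_rcons size_rcons ltnS => /andP[pp zl] <- sp.
rewrite inE; apply/orP; right; apply/existsP; exists (last v p).
by rewrite (IH p).
Qed.

(** [ball] follows walks while [dist] minimizes over duplicate-free paths; shortening a walk to a
    path does not increase its length. *)
Lemma out_ballE v r : out_ball v r = ball r v.
Proof.
apply/setP => u; rewrite inE /dist.
apply/idP/ballP; case: {-}_ / idP => [uv|nuv] //.
- case: ex_minnP => m /existsP[p /and3P[pp /eqP pl _]] _ mr.
  by exists p; rewrite size_tuple.
- move=> [p [pp pl sp]]; case: ex_minnP => m _ minm; apply: leq_trans sp.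
  move: pl; case/shortenP: pp => q pq uq qp ql.
  apply: leq_trans (_ : size q <= _); last first.
    by apply: uniq_leq_size qp; case/andP: uq.
  by apply: minm; apply/existsP; exists (in_tuple q); rewrite pq ql eqxx.
- by move=> [p [pp pl _]]; case: nuv; apply/connectP; exists p.
Qed.

Lemma ball_self r v : v \in ball r v.
Proof. by apply/ballP; exists [::]. Qed.

Lemma arc_ball1 v u r : 0 < r -> darc v u -> u \in ball r v.
Proof. by move=> r0 vu; apply/ballP; exists [:: u]; rewrite /= vu. Qed.

Definition source v : bool := [forall w, ~~ darc w v].

Lemma source_ball s r v : source s -> (s \in ball r v) = (s == v).
Proof.
move=> /forallP src; apply/idP/eqP => [|->]; last exact: ball_self.
elim: r => [|r IH]; rewrite /= inE; first by move/eqP.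
case/orP=> [//|/existsP[w]].
by rewrite (negbTE (src w)) andbF.
Qed.

(** Radii from the order on impose nothing, as no set has more vertices than that; the condition
    becomes finite. *)
Definition multipackingb S : bool :=
  [forall r : 'I_(dorder D), forall v, (0 < r) ==> (#|ball r v :&: S| <= r)].

Lemma multipackingP S : reflect (multipacking S) (multipackingb S).
Proof.
apply: (iffP forallP) => mS => [v r r1|r].
  rewrite out_ballE; have [rn|nr] := ltnP r (dorder D).
    by have /forallP/(_ v)/implyP := mS (Ordinal rn); apply.
  by apply: leq_trans nr; rewrite -[X in _ <= X]card_ord max_card.
by apply/forallP => v; apply/implyP => r0; rewrite -out_ballE mS.
Qed.

Lemma multipacking_card S v r :
  multipacking S -> 0 < r -> #|ball r v :&: S| <= r.
Proof. by move=> mS r0; rewrite -out_ballE mS. Qed.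

Definition twin u v : bool :=
  [forall w, (darc w u == darc w v) && (darc u w == darc v w)].

Lemma twinP u v :
  reflect ((forall w, darc w u = darc w v) /\ (forall w, darc u w = darc v w))
          (twin u v).
Proof.
apply: (iffP forallP) => [uv|[uv vu] w]; last by rewrite uv vu !eqxx.
by split=> w; have /andP[/eqP ? /eqP ?] := uv w.
Qed.

Lemma twin_sym u v : twin u v = twin v u.
Proof.
by apply: eq_forallb => w; rewrite [darc w u == _]eq_sym [darc u w == _]eq_sym.
Qed.

Lemma twin_source u v : twin u v -> source u = source v.
Proof. by case/twinP=> uv _; apply: eq_forallb => w; rewrite uv. Qed.

Lemma tperm_darc u v x y :
  twin u v -> darc (tperm u v x) (tperm u v y) = darc x y.
Proof.
case/twinP=> uv vu.
by case: tpermP => [->|->|_ _]; case: tpermP => [->|->|_ _];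
   rewrite ?uv ?vu -?uv -?vu.
Qed.

Lemma tperm_ball u v r x y :
  twin u v -> (tperm u v y \in ball r (tperm u v x)) = (y \in ball r x).
Proof.
move=> uv; elim: r y => [|r IH] y; rewrite /= !inE ?(inj_eq perm_inj) //.
rewrite IH; congr (_ || _); apply/existsP/existsP => -[w /andP[wx wy]].
  by exists (tperm u v w); rewrite -IH tpermK wx -(tperm_darc _ _ uv) tpermK.
by exists (tperm u v w); rewrite IH wx tperm_darc.
Qed.

Lemma card_tperm_ball u v r x S :
  twin u v ->
  #|ball r (tperm u v x) :&: tperm u v @: S| = #|ball r x :&: S|.
Proof.
move=> uv; rewrite -[RHS](card_imset _ (@perm_inj _ (tperm u v))).
congr #|pred_of_set _|; rewrite imsetI; last by move=> ? ? _ _; apply: perm_inj.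
congr (_ :&: _); apply/setP => y; apply/idP/imsetP => [yx|[z zx ->]].
  by exists (tperm u v y); rewrite ?tpermK // -(tperm_ball _ _ _ uv) tpermK.
by rewrite tperm_ball.
Qed.

Lemma multipacking_tperm u v S :
  twin u v -> multipacking S -> multipacking (tperm u v @: S).
Proof.
move=> uv mS x r r1; rewrite out_ballE -[x](tpermK u v) card_tperm_ball //.
exact: multipacking_card.
Qed.

(** The source [u] lies in no ball centred elsewhere, so only the balls around [u] could be
    overfull. The transposition of [u] and [v] preserves [u |: S] and carries the balls around [v]
    to those around [u], which reduces this case to the centre [v]. *)
Lemma multipacking_setU1 u v S :
  twin u v -> source v -> v \in S -> multipacking S -> multipacking (u |: S).
Proof.
move=> uv srcv vS mS.
have [uS|uS] := boolP (u \in S); first by rewrite (setUidPr _) ?sub1set.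
have srcu : source u by rewrite (twin_source uv).
have vu : v != u by apply: contraNneq uS => <-.
have off x r : x != u -> 0 < r -> #|ball r x :&: (u |: S)| <= r.
  move=> xu r0; rewrite setIUr (_ : _ :&: [set u] = set0) ?set0U.
    exact: multipacking_card.
  by apply/setP => z; rewrite !inE; case: eqP => [->|]; rewrite ?andbF //
    source_ball // eq_sym (negbTE xu).
move=> x r r1; rewrite out_ballE.
have [->|] := eqVneq x u; last by move=> xu; apply: off.
have -> : u |: S = tperm u v @: (u |: S).
  apply/setP => z; rewrite -{2}[z](tpermK u v) mem_imset; last exact: perm_inj.
  by rewrite !inE; case: tpermP => [->|->|_ _] //; rewrite ?eqxx ?vS ?orbT.
by rewrite -{1}[u](tpermR u v) card_tperm_ball // off.
Qed.

Lemma multipacking_twin u v S :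
  twin u v -> ~~ source v -> multipacking S -> v \in S -> u \in S -> u = v.
Proof.
move=> uv; rewrite negb_forall => /existsP[w]; rewrite negbK => wv mS vS uS.
apply/eqP; have := multipacking_card w mS (ltnSn 0); apply: contraTT => uDv.
rewrite -ltnNge; suff : [set u; v] \subset ball 1 w :&: S.
  by move/subset_leq_card; rewrite cards2 uDv.
have wu : darc w u by have [->] := twinP _ _ uv.
by apply/subsetP => z /set2P[]->; rewrite inE arc_ball1.
Qed.

Definition repr_twin v : bool := ~~ [exists u : V, (u < v) && twin u v].

(** The condition is a recurrence along the order of the vertices: membership of a
    non-representative is read off smaller vertices, so one increasing scan reconstructs the set. *)
Definition canonical S : Prop := forall v, ~~ repr_twin v ->
  (v \in S) = source v && [exists u : V, [&& u < v, u \in S & twin u v]].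

(* Among the multipackings at least as large as [S], one that maximizes the    *)
(* sum of the [n - x] is canonical: adding a twin of a selected source, or     *)
(* moving a selected vertex to a smaller twin, would increase this sum.        *)
Lemma canonical_multipacking S :
  multipacking S ->
  exists S', [/\ multipacking S', canonical S' & #|S| <= #|S'|].
Proof.
move=> mS; pose P S' := multipackingb S' && (#|S| <= #|S'|).
pose Phi (S' : {set V}) := \sum_(x in S') (dorder D - x).
have PS : P S by rewrite /P leqnn andbT; apply/multipackingP.
have [S' /andP[/multipackingP mS' SS'] maxS'] := @arg_maxnP _ S P Phi PS.
exists S'; split=> // v; rewrite negbK => /existsP[u /andP[uv twuv]].
have vu : v != u by rewrite -val_eqE gtn_eqF.
have [srcv|nsrcv] /= := boolP (source v).
  have add x y : twin x y -> source y -> y \in S' -> x \in S'.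
    move=> xy srcy yS'; have mS1 := multipacking_setU1 xy srcy yS' mS'.
    apply: contraT => xS'; have := maxS' (x |: S').
    rewrite /Phi big_setU1 //=; case/(_ _)/Wrap=> [|/=].
      apply/andP; split; first exact/multipackingP.
      by rewrite cardsU1 xS' ltnW.
    by have := ltn_ord x; lia.
  apply/idP/existsP => [vS'|[z /and3P[zv zS' twzv]]].
    by exists u; rewrite uv twuv (add u v).
  by apply: (add v z) => //; rewrite ?(twin_source twzv) // twin_sym.
apply: contraTF (isT) => vS' /=; apply/negP => _.
have uS' : u \notin S'.
  by apply: contra vu => uS'; rewrite eq_sym (multipacking_twin twuv nsrcv mS').
have := maxS' (tperm u v @: S'); case/(_ _)/Wrap=> [|].
  rewrite /P card_imset; last exact: perm_inj.
  by rewrite SS' andbT; apply/multipackingP/multipacking_tperm.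
rewrite /Phi big_imset /=; last by move=> ? ? _ _; apply: perm_inj.
rewrite (bigD1 v) //= tpermR (bigD1 v (P := mem S')) //=.
rewrite (eq_bigr (fun x : V => dorder D - x)).
  by have := ltn_ord v; lia.
move=> x /andP[xS' xv]; rewrite tpermD //; last by rewrite eq_sym.
by apply: contraNneq uS' => ->.
Qed.

(** Outside a minimum cover X all neighbours lie in X, so two vertices with the same in- and
    out-neighbourhoods in X are twins, and the larger is not a representative. Representatives
    outside X thus inject into pairs of subsets of X. *)
Lemma card_repr_twin :
  #|repr_twin| <= 2 ^ (vertex_cover_number D).*2.+1.
Proof.
rewrite /vertex_cover_number; case: arg_minnP; first exact: vertex_cover_setT.
move=> X /forallP cX _.
pose nbrs v := ([set w in X | darc w v], [set w in X | darc v w]).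
(* The bound is split as 4 ^ c + 4 ^ c: the representatives inside X number at most c < 2 ^ c, the
   others at most 4 ^ c. *)
rewrite -(cardID (mem X) repr_twin) expnS mul2n -[leqRHS]addnn leq_add //.
  apply: leq_trans (subset_leq_card (_ : _ \subset X)) _.
    by apply/subsetP => v; rewrite inE => /andP[].
  apply: ltnW; apply: leq_trans (ltn_expl _ (ltnSn 1)) _.
  by rewrite leq_exp2l // -addnn leq_addr.
rewrite -(card_in_image (f := nbrs)).
  apply: leq_trans
    (subset_leq_card (_ : _ \subset setX (powerset X) (powerset X))) _.
    apply/subsetP => _ /imageP[v _ ->]; rewrite !inE.
    by apply/andP; split; apply/subsetP => w; rewrite inE => /andP[].
  by rewrite cardsX card_powerset -expnD addnn.
have sub u v : u < v -> u \notin X -> v \notin X -> nbrs u = nbrs v ->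
    ~~ repr_twin v.
  move=> uv uX vX [/setP inE1 /setP inE2]; rewrite negbK; apply/existsP; exists u.
  rewrite uv; apply/twinP; split=> w.
    have [wX|wX] := boolP (w \in X); first by have := inE1 w; rewrite !inE wX.
    have no x : x \notin X -> darc w x = false.
      move=> xX; apply/negP => wx; have /forallP/(_ x) := cX w.
      by rewrite wx (negbTE wX) (negbTE xX).
    by rewrite !no.
  have [wX|wX] := boolP (w \in X); first by have := inE2 w; rewrite !inE wX.
  have no x : x \notin X -> darc x w = false.
    move=> xX; apply/negP => xw; have /forallP/(_ w) := cX x.
    by rewrite xw (negbTE wX) (negbTE xX).
  by rewrite !no.
move=> u v; rewrite !inE => /andP[uX ru] /andP[vX rv] nuv.
case: (ltngtP u v) => [uv|vu|/val_inj //].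
  by case/negP: (sub _ _ uv uX vX nuv).
by case/negP: (sub _ _ vu vX uX (esym nuv)).
Qed.

End Balls.

(** * The algorithm *)

Definition arc_expr (e1 e2 : expr) : expr := Fetch 0 (Add (Fetch 1 e1) e2).

(** Multiplication by n is a look-up in array 1. It is applied to r * n + v as well, hence the table
    of n * n multiples. *)
Definition ball_expr (e1 e2 e3 : expr) : expr :=
  Fetch 2 (Add (Fetch 1 (Add (Fetch 1 e1) e2)) e3).

(** Subtraction being truncated, [distinct] is the absolute difference; the sum vanishes exactly for
    twins. *)
Definition Twin (d x y : nat) : program :=
  let w := Reg d.+1 in
  let distinct e1 e2 := Add (Defs.Sub e1 e2) (Defs.Sub e2 e1) in
  Not d (Sum d (Assign d.+2
    (Add (distinct (arc_expr w (Reg x)) (arc_expr w (Reg y)))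
         (distinct (arc_expr (Reg x) w) (arc_expr (Reg y) w))))).

Definition Smaller_twin (d x : nat) : program :=
  Sum d (And d.+2 (Assign d.+2 (Defs.Sub (Reg x) (Reg d.+1)))
                  (Twin d.+2 d.+1 x)).

Definition Source (d x : nat) : program :=
  Not d (Sum d (Assign d.+2 (arc_expr (Reg d.+1) (Reg x)))).

(** A test may leave any nonzero value, whereas counting by [Sum] needs exactly 1. *)
Definition Indicator (d : nat) (p : program) : program :=
  IfThenElse d p (Assign d (Const 1)) (Assign d (Const 0)).

Lemma computes_indicator d p s b :
  computes d p s (is_true_iff b) -> computes d (Indicator d p) s (eq (b : nat)).
Proof.
move=> h; apply: (computes_if h) => [m s' _ <- m0|s' _ <-].
  by apply: computes_assign; rewrite m0.
by apply: computes_assign.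
Qed.

(** * Correctness of the tests for twins, representatives and sources *)

Section Tests.

Variable D : digraph.
Local Notation n := (dorder D).
Local Notation V := 'I_n.
Implicit Types (u v w : V) (s : state) (S : {set V}).

Definition indexed s : Prop :=
  [/\ reg s 0 = n, arr s 0 = (fun m => adjacency_cell D m : nat) &
      forall i, i < n * n -> arr s 1 i = i * n].

Lemma index_inj i j u v : i * n + u = j * n + v -> i = j /\ u = v.
Proof.
move=> ijuv; have n0 : 0 < n by apply: leq_ltn_trans (ltn_ord u).
have := congr1 (divn^~ n) ijuv; rewrite /= !divnMDl // !divn_small // !addn0.
move=> ij; split=> //; apply: val_inj.
by move: ijuv; rewrite ij => /addnI.
Qed.

Lemma ltn_index i j u : i < j -> i * n + u < j * n.
Proof.
move=> ij; apply: leq_trans (_ : i.+1 * n <= _); last by rewrite leq_mul2r ij orbT.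
by rewrite mulSn addnC ltn_add2r.
Qed.

Lemma adjacency_cellE u v : adjacency_cell D (u * n + v) = darc u v.
Proof.
apply/existsP/idP => [[i /existsP[j /andP[/eqP /index_inj[ui ->]]]]|uv].
  by rewrite (val_inj ui).
by exists u; apply/existsP; exists v; rewrite eqxx.
Qed.

Lemma indexed_extends d s s' : extends d s s' -> 0 < d -> indexed s -> indexed s'.
Proof. by move=> [a r] d0 [s0 sA sI]; split; rewrite ?a ?r. Qed.

Lemma eval_arc s e1 e2 u v :
  indexed s -> eval s e1 = u -> eval s e2 = v ->
  eval s (arc_expr e1 e2) = darc u v.
Proof.
move=> [_ sA sI] /= -> ->; rewrite sA sI ?adjacency_cellE //.
by have := ltn_ord u; have := ltn_ord v; nia.
Qed.

Lemma eval_ball s e1 e2 e3 r v u :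
  indexed s -> r < n -> eval s e1 = r -> eval s e2 = v -> eval s e3 = u ->
  eval s (ball_expr e1 e2 e3) = arr s 2 ((r * n + v) * n + u).
Proof.
move=> [_ sA sI] rn /= -> -> ->.
by rewrite (sI r) ?sI //; [apply: ltn_index|nia].
Qed.

Lemma computes_twin d x y s u v :
  indexed s -> x < d -> y < d -> reg s x = u -> reg s y = v ->
  computes d (Twin d x y) s (is_true_iff (twin u v)).
Proof.
move=> sD xd yd sx sy; have d0 : 0 < d by apply: leq_ltn_trans xd.
have -> : twin u v =
    ~~ [exists w, ~~ ((darc w u == darc w v) && (darc u w == darc v w))].
  by rewrite negb_exists; apply: eq_forallb => w; rewrite negbK.
apply: computes_not; apply: computes_exists => //; first by case: sD.
move=> w s' ext s'w; apply: computes_assign.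
have sD' := indexed_extends ext d0 sD.
have {}sx : reg s' x = u by rewrite ext.2.
have {}sy : reg s' y = v by rewrite ext.2.
move: (eval_arc (e1 := Reg d.+1) (e2 := Reg x) sD' s'w sx).
move: (eval_arc (e1 := Reg d.+1) (e2 := Reg y) sD' s'w sy).
move: (eval_arc (e2 := Reg d.+1) (e1 := Reg x) sD' sx s'w).
move: (eval_arc (e2 := Reg d.+1) (e1 := Reg y) sD' sy s'w).
rewrite /is_true_iff /= => -> -> -> ->.
by do 4 case: (darc _ _).
Qed.

Lemma computes_smaller_twin d x s v :
  indexed s -> 0 < d -> x < d -> reg s x = v ->
  computes d (Smaller_twin d x) s (is_true_iff (~~ repr_twin v)).
Proof.
move=> sD d0 xd sx; rewrite negbK.
apply: computes_exists => //; first by case: sD.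
move=> u s' ext s'u; apply: computes_and.
  apply: computes_assign.
  by rewrite /is_true_iff /= s'u ext.2 // sx subn_eq0 -ltnNge.
move=> _ s2 ext2; apply: computes_twin => //.
- by apply: indexed_extends ext2 _ _ => //; apply: indexed_extends ext _ _.
- by rewrite ltnW // ltnW.
- by rewrite ext2.2.
- by rewrite ext2.2 ?ext.2 // ltnW // ltnW.
Qed.

Lemma computes_source d x s v :
  indexed s -> 0 < d -> x < d -> reg s x = v ->
  computes d (Source d x) s (is_true_iff (source v)).
Proof.
move=> sD d0 xd sx; rewrite /source -negb_exists.
apply: computes_not; apply: computes_exists => //; first by case: sD.
move=> u s' ext s'u; apply: computes_assign.
rewrite /is_true_iff (eval_arc (u := u) (v := v)) ?eqb0 ?negbK //.
  exact: indexed_extends ext _ _.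
by rewrite /= ext.2.
Qed.

End Tests.

(* Arrays: 1 holds the multiples of the order n, 2 the indicators of the balls *)
(* ([u] in the ball of radius [r] around [v] at index [(r * n + v) * n + u]),  *)
(* 5 and 6 the halves and the parities of the numbers less than the number of  *)
(* candidates, which is in register 2, and 7 the current candidate set.        *)
(* Register 8 holds the answer, the registers from 10 on are temporaries.      *)
Definition Row_table : program :=
  For 5 0 (For 6 0
    (Seq (Store 1 (Reg 3) (Reg 4))
    (Seq (Assign 4 (Add (Reg 4) (Reg 0)))
         (Assign 3 (Add (Reg 3) (Const 1)))))).

(* Is [u] (register 7) in the ball of radius [r] (register 5) around [v]       *)
(* (register 6)?  The smaller balls have already been tabulated.               *)
Definition In_ball : program :=
  let r' := Defs.Sub (Reg 5) (Const 1) in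
  IfThenElse 10 (Assign 10 (Reg 5))
    (Or 10 (Assign 10 (ball_expr r' (Reg 6) (Reg 7)))
           (Sum 10 (And 12 (Assign 12 (ball_expr r' (Reg 6) (Reg 11)))
                           (Assign 12 (arc_expr (Reg 11) (Reg 7))))))
    (Not 10 (Assign 10
      (Add (Defs.Sub (Reg 6) (Reg 7)) (Defs.Sub (Reg 7) (Reg 6))))).

Definition Ball_table : program :=
  Seq (Assign 3 (Const 0))
    (For 5 0 (For 6 0 (For 7 0
      (Seq In_ball (Seq (Store 2 (Reg 3) (Reg 10))
                        (Assign 3 (Add (Reg 3) (Const 1)))))))).

Definition Candidates : program :=
  Seq (Assign 2 (Const 1))
    (For 6 0 (Seq (Smaller_twin 10 6)
                  (If (Reg 10) Skip (Assign 2 (Add (Reg 2) (Reg 2)))))).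

(** Halving is tabulated by the recurrence: half of i + 1 is half of i plus the parity of i, and the
    parity alternates. The entries at 0 are correct in the initial memory. *)
Definition Half_table : program :=
  For 5 2
    (Seq (Store 5 (Add (Reg 5) (Const 1)) (Add (Fetch 5 (Reg 5)) (Fetch 6 (Reg 5))))
         (Store 6 (Add (Reg 5) (Const 1)) (Defs.Sub (Const 1) (Fetch 6 (Reg 5))))).

Definition Source_with_selected_twin : program :=
  And 10 (Source 10 6)
    (Sum 10 (And 12 (Assign 12 (Defs.Sub (Reg 6) (Reg 11)))
            (And 12 (Assign 12 (Fetch 7 (Reg 11))) (Twin 12 11 6)))).

(* The binary digits of register 5 tell which class representatives are        *)
(* selected; register 3 holds the digits that have not been read yet.          *)
Definition Select : program :=
  Seq (Assign 3 (Reg 5))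
    (For 6 0 (Seq (Smaller_twin 10 6)
      (If (Reg 10)
         (Seq Source_with_selected_twin (Store 7 (Reg 6) (Reg 10)))
         (Seq (Store 7 (Reg 6) (Fetch 6 (Reg 3)))
              (Assign 3 (Fetch 5 (Reg 3))))))).

(** The truncated difference of the count and the radius is nonzero exactly for an overfull ball. *)
Definition Violation : program :=
  Sum 10 (And 12 (Assign 12 (Reg 11))
    (Sum 12 (Apply 14
      (Sum 14 (Indicator 16
         (And 16 (Assign 16 (ball_expr (Reg 11) (Reg 13) (Reg 15)))
                 (Assign 16 (Fetch 7 (Reg 15))))))
      (Defs.Sub (Reg 14) (Reg 11))))).

Definition Large : program :=
  Not 10 (Apply 10 (Sum 10 (Indicator 12 (Assign 12 (Fetch 7 (Reg 11)))))
                   (Defs.Sub (Reg 1) (Reg 10))).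

Definition Check_multipacking : program :=
  And 10 (Not 10 Violation) Large.

Definition Search_candidates : program :=
  For 5 2 (Seq Select (Seq Check_multipacking
    (If (Reg 10) (Assign 8 (Const 1)) Skip))).

(** The program is cut here because [exec_time_bound] wants loop bounds that are not written:
    register 2, a loop bound of [Enumerate], is computed in this phase. *)
Definition Preprocess : program := Seq Row_table (Seq Ball_table Candidates).

Definition Enumerate : program := Seq Half_table Search_candidates.

Definition Multipacking_program : program :=
  Seq Preprocess (Seq Enumerate (Assign 0 (Reg 8))).

(** * Correctness of the tables, of the decoding and of the search *)

Section Correctness.

Variable D : digraph.
Local Notation n := (dorder D).
Local Notation V := 'I_n.
Implicit Types (u v w : V) (s : state) (S : {set V}).

Lemma runs_row_table s :
  reg s 0 = n -> reg s 3 = 0 -> reg s 4 = 0 ->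
  runs Row_table s (fun s' => forall i, i < n * n -> arr s' 1 i = i * n).
Proof.
move=> s0 s3 s4.
pose I m s := [/\ reg s 3 = m, reg s 4 = m * n &
  forall j, j < m -> arr s 1 j = j * n].
apply: (@runs_conseq _ _ (I (reg s 0 * n))); last first.
  by move=> s' _ [_ _]; rewrite s0.
apply: (@runs_for_frame _ _ _ _ (fun i => I (i * n))) => //.
move=> i s1 _ _ fr1 I1; rewrite mulSn addnC.
have s10 : reg s1 0 = n by rewrite fr1.1.
rewrite -[X in _ + X]s10.
apply: runs_conseq
  (@runs_for_frame _ _ _ _ (fun j => I (i * n + j)) _ _ _ _ _) _ => //.
  by rewrite addn0.
move=> j s2 _ _ fr2 [s23 s24 s2a].
have s20 : reg s2 0 = n by rewrite fr2.1.
apply: runs_seq; apply: runs_store; apply: runs_seq; apply: runs_assign.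
apply: runs_assign; split => /=.
- by rewrite s23 addn1 addnS.
- by rewrite s24 s20 addnS mulSn addnC.
- move=> l; rewrite addnS ltnS leq_eqVlt s23 s24 => /predU1P[->|lj].
    by rewrite eqxx.
  by rewrite (ltn_eqF lj) s2a.
Qed.

Lemma computes_in_ball s r v u :
  indexed D s -> r < n -> reg s 5 = r -> reg s 6 = v -> reg s 7 = u ->
  (0 < r -> forall w,
     (arr s 2 ((r.-1 * n + v) * n + w) != 0) = (w \in ball r.-1 v)) ->
  computes 10 In_ball s (is_true_iff (u \in ball r v)).
Proof.
move=> sD rn s5 s6 s7 sB.
apply: (@computes_if _ _ _ _ _ (eq r)) => [|_ s' ext <-|s' ext r0].
- exact: computes_assign.
- rewrite -lt0n => r0; have := sB r0.
  case: r r0 rn s5 {sB} => // r _ rn s5 /= sB; rewrite inE.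
  have sD' := indexed_extends ext isT sD.
  apply: computes_or.
    apply: computes_assign.
    rewrite /is_true_iff (eval_ball (r := r) (v := v) (u := u)) /=
      ?ext.2 ?ext.1 ?sB //.
    + exact: ltnW.
    + by rewrite s5 subn1.
  move=> s2 ext2; have sD2 := indexed_extends ext2 isT sD'.
  apply: computes_exists => //; first by case: sD2.
  move=> w s3 ext3 s3w; have sD3 := indexed_extends ext3 isT sD2.
  apply: computes_and.
    apply: computes_assign.
    rewrite /is_true_iff (eval_ball (r := r) (v := v) (u := w)) /=
      ?ext3.1 ?ext2.1 ?ext.1 ?sB //.
    + exact: ltnW.
    + by rewrite ext3.2 // ext2.2 // ext.2 // s5 subn1.
    + by rewrite ext3.2 // ext2.2 // ext.2.
  move=> _ s4 ext4; apply: computes_assign.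
  rewrite /is_true_iff (eval_arc (D := D) (u := w) (v := u)) /= ?eqb0 ?negbK //.
  + exact: indexed_extends ext4 _ _.
  + by rewrite ext4.2.
  + by rewrite ext4.2 // ext3.2 // ext2.2 // ext.2.
- rewrite r0 inE (_ : (u == v) = ~~ (u != v)); last by rewrite negbK.
  apply: computes_not; apply: computes_assign.
  by rewrite /is_true_iff /= !ext.2 // s6 s7 addn_eq0 !subn_eq0 -eqn_leq eq_sym.
Qed.

Lemma runs_ball_table s :
  indexed D s ->
  runs Ball_table s (fun s' => forall r v u, r < n ->
    (arr s' 2 ((r * n + v) * n + u) != 0) = (u \in ball r v)).
Proof.
move=> sD; have n0 : reg s 0 = n by case: sD.
(* The three nested loops fill the table in index order, so a single invariant on the running index
   in register 3 serves all of them. *)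
pose I m s := reg s 3 = m /\
  forall r v u, (r * n + v) * n + u < m ->
    (arr s 2 ((r * n + v) * n + u) != 0) = (u \in ball r v).
apply: runs_seq; apply: runs_assign; set s0 := set_reg _ _ _.
have s00 : reg s0 0 = n by [].
apply: (@runs_conseq _ _ (I (reg s0 0 * n * n))); last first.
  by move=> s' _ [_ h] r v u rn; apply: h; rewrite s00; do 2 apply: ltn_index.
apply: (@runs_for_frame _ _ _ _ (fun i => I (i * n * n))) => //.
move=> r s1; rewrite s00 => rn s15 fr1 I1.
have s10 : reg s1 0 = n by rewrite fr1.1.
rewrite mulSn addnC -[X in _ + X]s10.
apply: runs_conseq
  (@runs_for_frame _ _ _ _ (fun j => I ((r * n + j) * n)) _ _ _ _ _) _ => //.
  by rewrite addn0.
move=> j s2; rewrite s10 => jn s26 fr2 I2.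
have s20 : reg s2 0 = n by rewrite fr2.1.
rewrite addnS mulSn addnC -[X in _ + X]s20.
apply: runs_conseq
  (@runs_for_frame _ _ _ _ (fun l => I ((r * n + j) * n + l)) _ _ _ _ _) _ => //.
  by rewrite addn0.
move=> l s3; rewrite s20 => ln s37 fr3 [s33 I3].
have sD3 : indexed D s3.
  case: sD => _ sA sI.
  by split; rewrite ?fr3.1 // ?fr3.2 // ?fr2.2 // ?fr1.2.
have s35 : reg s3 5 = r by rewrite fr3.1 // fr2.1.
have s36 : reg s3 6 = j by rewrite fr3.1.
apply: runs_seq.
have := @computes_in_ball s3 r (Ordinal jn) (Ordinal ln) sD3 rn s35 s36 s37.
case/(_ _)/Wrap=> [r0 w|].
  (* Radius is the outermost loop, so the entries of radius r - 1 precede the current index and are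
     already correct. *)
  apply: I3 => /=; apply: leq_trans (leq_addr _ _).
  apply: ltn_index; rewrite /= ltn_add2r ltn_mul2r prednK // leqnn.
  by rewrite (leq_ltn_trans _ jn).
move/runs_conseq; apply=> s4 fr4 [ext4 s4b].
apply: runs_seq; apply: runs_store; apply: runs_assign; split => /=.
  by rewrite ext4.2 // s33 addn1 addnS.
move=> r' v u; rewrite ext4.2 // s33 addnS ltnS leq_eqVlt => /predU1P[E|lt].
  rewrite E eqxx s4b; have [E1 ->] := @index_inj D _ _ u (Ordinal ln) E.
  by have [-> ->] := @index_inj D _ _ v (Ordinal jn) E1.
rewrite (ltn_eqF lt).
by rewrite ext4.1 I3.
Qed.

Lemma indexed_frame p s s' :
  frame p s s' -> 0 \notin written_regs p ->
  0 \notin written_arrs p -> 1 \notin written_arrs p ->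
  indexed D s -> indexed D s'.
Proof. by move=> [r a] r0 a0 a1 [s0 sA sI]; split; rewrite ?r ?a. Qed.

Lemma drop_enum_ord i (iN : i < n) :
  drop i (enum V) = Ordinal iN :: drop i.+1 (enum V).
Proof.
rewrite (drop_nth (Ordinal iN)) ?size_enum_ord //.
by rewrite -[X in nth _ _ X]/(val (Ordinal iN)) nth_ord_enum.
Qed.

Lemma drop_enum_ord_n : drop n (enum V) = [::].
Proof. by rewrite drop_oversize // size_enum_ord. Qed.

Lemma runs_candidates s :
  indexed D s -> runs Candidates s (fun s' => reg s' 2 = 2 ^ #|@repr_twin D|).
Proof.
move=> sD; have s0 : reg s 0 = n by case: sD.
pose c i := count (@repr_twin D) (drop i (enum V)).
have -> : #|@repr_twin D| = c 0.
  by rewrite /c drop0 enumT cardE /enum_mem size_filter.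
apply: runs_seq; apply: runs_assign; set s1 := set_reg _ _ _.
(* [c i] counts the representatives not yet scanned, each of which will still double register 2. *)
pose I i s := reg s 2 * 2 ^ c i = 2 ^ c 0.
apply: (@runs_conseq _ _ (I (reg s1 0))); last first.
  by move=> s' _; rewrite /I /= s0 {1}/c drop_enum_ord_n muln1.
apply: runs_for_frame => //; first by rewrite /I /= mul1n.
move=> i s2 iN s26 fr2 I2; rewrite /= s0 in iN.
have sD2 : indexed D s2 by apply: (indexed_frame fr2).
apply: runs_seq.
have /runs_conseq := @computes_smaller_twin D 10 6 s2 (Ordinal iN) sD2 isT isT s26.
apply=> s3 _ [ext3 s3b]; rewrite /is_true_iff in s3b.
have I3 : reg s3 2 * 2 ^ (repr_twin (Ordinal iN) + c i.+1) = 2 ^ c 0.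
  by rewrite ext3.2 // -I2 /c (drop_enum_ord iN).
apply: runs_if => /= s3r.
  apply: runs_skip; rewrite /I /= -I3.
  by move: s3b; rewrite s3r => /esym/negbTE->.
apply: runs_assign; rewrite /I /= -I3.
by move: s3b; rewrite s3r => /esym/negbFE->; rewrite expnS mulnA addnn muln2.
Qed.

Definition half_odd s (N : nat) : Prop :=
  forall t, t < N -> arr s 5 t = t./2 /\ arr s 6 t = odd t.

Lemma runs_half_table s :
  arr s 5 0 = 0 -> arr s 6 0 = 0 ->
  runs Half_table s (fun s' => half_odd s' (reg s 2)).
Proof.
move=> s5 s6; apply: (@runs_conseq _ _ (fun s' => half_odd s' (reg s 2).+1)).
  apply: (@runs_for_frame _ _ _ _ (fun i s' => half_odd s' i.+1)) => //.
    by case.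
  move=> i s1 _ s15 _ I1; apply: runs_seq; apply: runs_store; apply: runs_store.
  move=> t /=; rewrite s15 addn1 ltnS leq_eqVlt => /predU1P[->|ti].
    have [-> ->] := I1 i (ltnSn i); rewrite eqxx -uphalfE uphalf_half addnC.
    by split=> //=; case: (odd i).
  by rewrite (ltn_eqF ti); apply: I1.
by move=> s' _ h t tN; apply: h; apply: ltnW.
Qed.

(* [Select] decodes [code S (enum V)] to [S] when [S] is canonical.            *)
Fixpoint code S (l : seq V) : nat :=
  if l is v :: l' then
    if repr_twin v then (v \in S) + (code S l').*2 else code S l'
  else 0.

(** Hence the search up to register 2 meets the code of every canonical set. *)
Lemma code_ltn S l : code S l < 2 ^ count (@repr_twin D) l.
Proof.
elim: l => //= v l IH; case: (repr_twin v) => //=.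
by rewrite add1n expnS mul2n; case: (v \in S) => /=; lia.
Qed.

Definition selected s : {set V} := [set u : V | arr s 7 u != 0].

(** Array 7 may still hold the previous candidate: each entry is rewritten in increasing order, and
    only entries of smaller vertices are consulted. *)
Lemma runs_select s t :
  indexed D s -> reg s 5 = t -> half_odd s t.+1 ->
  runs Select s (fun s' =>
    forall S, canonical S -> code S (enum V) = t -> selected s' = S).
Proof.
move=> sD s5 ho; have s0 : reg s 0 = n by case: sD.
apply: runs_seq; apply: runs_assign; set s1 := set_reg _ _ _.
(* The first conjunct keeps the unread digits within the tabulated range of arrays 5 and 6. *)
pose I i s := reg s 3 <= t /\
  forall S, canonical S -> code S (enum V) = t ->
    reg s 3 = code S (drop i (enum V)) /\
    forall u, u < i -> (arr s 7 u != 0) = (u \in S).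
apply: (@runs_conseq _ _ (I (reg s1 0))); last first.
  move=> s' _ [_ h] S cS St; have [_ {}h] := h S cS St.
  by apply/setP => u; rewrite inE h //= s0.
apply: runs_for_frame => //.
  by split=> [|S cS St]; rewrite /= s5 // drop0 St.
move=> i s2 iN s26 fr2 [le2 I2]; rewrite /= s0 in iN.
have sD2 : indexed D s2 by apply: (indexed_frame fr2).
set v : V := Ordinal iN.
apply: runs_seq.
have /runs_conseq := @computes_smaller_twin D 10 6 s2 v sD2 isT isT s26.
apply=> s3 _ [ext3 s3b]; rewrite /is_true_iff in s3b.
have sD3 := indexed_extends ext3 isT sD2.
have s36 : reg s3 6 = v by rewrite ext3.2.
have ltv s' S : (forall u, u < i -> (arr s' 7 u != 0) = (u \in S)) ->
    (arr s' 7 v != 0) = (v \in S) ->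
    forall u, u < i.+1 -> (arr s' 7 u != 0) = (u \in S).
  move=> h hv u; rewrite ltnS leq_eqVlt => /predU1P[ui|/h //].
  by rewrite (_ : u = v) //; apply: val_inj.
apply: runs_if => /= s3r.
  have nrv : ~~ repr_twin v by rewrite -s3b.
  pose b := source v && [exists u : V, [&& u < v, arr s3 7 u != 0 & twin u v]].
  apply: runs_seq.
  have h : computes 10 Source_with_selected_twin s3 (is_true_iff b).
    apply: computes_and; first exact: computes_source.
    move=> _ s4 ext4; apply: computes_exists => //.
      by rewrite ext4.2 //; case: sD3.
    move=> u s5' ext5 s5u.
    have sD5 := indexed_extends ext5 isT (indexed_extends ext4 isT sD3).
    have s56 : reg s5' 6 = v by rewrite ext5.2 // ext4.2.
    apply: computes_and.
      by apply: computes_assign; rewrite /is_true_iff /= s56 s5u subn_eq0 -ltnNge.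
    move=> _ s6 ext6; apply: computes_and.
      apply: computes_assign.
      by rewrite /is_true_iff /= ext6.2 // ext6.1 ext5.1 ext4.1 s5u.
    move=> _ s7 ext7; apply: computes_twin => //.
    - exact: indexed_extends ext7 _ (indexed_extends ext6 _ sD5).
    - by rewrite ext7.2 // ext6.2.
    - by rewrite ext7.2 // ext6.2.
  apply: (runs_conseq h) => s4 _ [ext4 s4b].
  apply: runs_store; split; first by rewrite /= ext4.2 // ext3.2.
  move=> S cS St; have [s23 s2S] := I2 S cS St; split.
    by rewrite /= ext4.2 // ext3.2 // s23 (drop_enum_ord iN) /= (negbTE nrv).
  apply: (ltv (set_arr _ _ _ _)) => [u ui|]; rewrite /= ext4.2 // s36.
    by rewrite (ltn_eqF (ui : u < v)) ext4.1 ext3.1 s2S.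
  rewrite eqxx /= (s4b : (_ != 0) = _) cS //; congr (_ && _).
  apply: eq_existsb => u; have [uv|//] := ltnP u v.
  by rewrite /= ext3.1 s2S.
have rv : repr_twin v by apply: negbFE; rewrite -s3b s3r.
apply: runs_seq; apply: runs_store; apply: runs_assign; split.
  rewrite /= ext3.2 // ext3.1 fr2.2 //=.
  by rewrite (ho _ _).1 ?ltnS // (leq_trans _ le2) // leq_half_double; lia.
move=> S cS St; have [s23 s2S] := I2 S cS St.
have lt3 : reg s2 3 < t.+1 by [].
have [e5 e6] : arr s2 5 = arr s 5 /\ arr s2 6 = arr s 6 by rewrite !fr2.2.
have := ho _ lt3; rewrite -e5 -e6.
rewrite (drop_enum_ord iN) /= rv in s23; rewrite {2 4}s23 => -[h5 h6]; split.
  by rewrite /= ext3.2 // ext3.1 h5 half_bit_double.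
apply: (ltv (set_reg _ _ _)) => [u ui|]; rewrite /= ext3.2 // ext3.2 // ext3.1.
  by rewrite s26 (ltn_eqF ui) s2S.
by rewrite s26 eqxx h6 oddD odd_double addbF; case: (_ \in _).
Qed.

Definition ball_table s : Prop := forall r v u, r < n ->
  (arr s 2 ((r * n + v) * n + u) != 0) = (u \in ball r v).

Lemma sum_mem (A : {pred V}) : \sum_u ((u \in A) : nat) = #|A|.
Proof.
by rewrite -sum1_card [RHS]big_mkcond; apply: eq_bigr => u _; case: (u \in A).
Qed.

Lemma computes_violation s :
  indexed D s -> ball_table s ->
  computes 10 Violation s (is_true_iff (~~ multipackingb (selected s))).
Proof.
move=> sD sB.
have -> : ~~ multipackingb (selected s) = [exists r : V,
    (0 < r) && [exists v, ~~ (#|ball r v :&: selected s| <= r)]].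
  rewrite negb_forall; apply: eq_existsb => r; rewrite negb_forall.
  apply/existsP/andP => [[v]|[r0 /existsP[v h]]].
    by rewrite negb_imply => /andP[r0 h]; split=> //; apply/existsP; exists v.
  by exists v; rewrite negb_imply r0.
apply: computes_exists => //; first by case: sD.
move=> r s1 ext1 s1r; have sD1 := indexed_extends ext1 isT sD.
apply: computes_and.
  by apply: computes_assign; rewrite /is_true_iff /= s1r lt0n.
move=> _ s2 ext2; have sD2 := indexed_extends ext2 isT sD1.
apply: computes_exists => //; first by case: sD2.
move=> v s3 ext3 s3v; have sD3 := indexed_extends ext3 isT sD2.
have s3r : reg s3 11 = r by rewrite ext3.2 // ext2.2.
apply: (@computes_apply _ _ _ _ (eq #|ball r v :&: selected s|)); last first.
  move=> s4 ext4 s4c; rewrite /is_true_iff /= -s4c ext4.2 // s3r.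
  by rewrite subn_eq0.
rewrite -sum_mem; apply: computes_sum => //; first by case: sD3.
move=> u s4 ext4 s4u; have sD4 := indexed_extends ext4 isT sD3.
have s4r : reg s4 11 = r by rewrite ext4.2.
have s4v : reg s4 13 = v by rewrite ext4.2.
apply: computes_indicator; rewrite inE; apply: computes_and.
  apply: computes_assign; rewrite /is_true_iff.
  rewrite (eval_ball (r := r) (v := v) (u := u)) //.
  by rewrite ext4.1 ext3.1 ext2.1 ext1.1 sB.
move=> _ s5 ext5; apply: computes_assign; rewrite /is_true_iff /= ext5.2 //.
by rewrite s4u ext5.1 ext4.1 ext3.1 ext2.1 ext1.1 inE.
Qed.

Lemma computes_large s :
  indexed D s -> computes 10 Large s (is_true_iff (reg s 1 <= #|selected s|)).
Proof.
move=> sD; rewrite -[_ <= _]negbK; apply: computes_not.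
apply: (@computes_apply _ _ _ _ (eq #|selected s|)); last first.
  by move=> s1 ext1 s1c; rewrite /is_true_iff /= -s1c ext1.2 // subn_eq0.
rewrite -sum_mem; apply: computes_sum => //; first by case: sD.
move=> u s1 ext1 s1u; apply: computes_indicator; apply: computes_assign.
by rewrite /is_true_iff /= s1u ext1.1 inE.
Qed.

Lemma computes_check s :
  indexed D s -> ball_table s ->
  computes 10 Check_multipacking s
    (is_true_iff (multipackingb (selected s) && (reg s 1 <= #|selected s|))).
Proof.
move=> sD sB; apply: computes_and => [|_ s1 ext1].
  by rewrite -[multipackingb _]negbK; apply/computes_not/computes_violation.
have sD1 := indexed_extends ext1 isT sD.
have := computes_large sD1.
by rewrite ext1.2 // (_ : selected s1 = selected s) // /selected ext1.1.
Qed.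

(** A positive answer is sound because the decoded set passes the check and is itself the witness,
    whatever its code; completeness comes from [runs_select] on canonical sets. *)
Lemma runs_search s :
  indexed D s -> ball_table s -> half_odd s (reg s 2) -> reg s 8 = 0 ->
  runs Search_candidates s (fun s' => exists b : bool,
    [/\ reg s' 8 = b, b -> Multipacking D (reg s 1) &
        forall S, canonical S -> multipacking S -> reg s 1 <= #|S| ->
          code S (enum V) < reg s 2 -> b]).
Proof.
move=> sD sB ho s8.
pose I i s' := exists b : bool,
    [/\ reg s' 8 = b, b -> Multipacking D (reg s 1) &
        forall S, canonical S -> multipacking S -> reg s 1 <= #|S| ->
          code S (enum V) < i -> b].
apply: (@runs_for_frame _ _ _ _ I) => //; first by exists false.
move=> i s1 iN s15 fr1 [b [s1b bD I1]].
have sD1 : indexed D s1 by apply: (indexed_frame fr1).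
have ho1 : half_odd s1 i.+1.
  by move=> t ti; rewrite !fr1.2 //; apply: ho; apply: leq_trans ti iN.
apply: runs_seq; apply: runs_conseq (runs_select sD1 s15 ho1) _ => s2 fr2 I2.
have sD2 : indexed D s2 by apply: (indexed_frame fr2).
have sB2 : ball_table s2 by move=> r v u rn; rewrite fr2.2 // fr1.2 // sB.
apply: runs_seq; apply: runs_conseq (computes_check sD2 sB2) _ => s3 _ [ext3 s3c].
have s21 : reg s2 1 = reg s 1 by rewrite fr2.1 // fr1.1.
have s28 : reg s2 8 = b by rewrite fr2.1.
rewrite /is_true_iff s21 in s3c; apply: runs_if => /= s3r.
  apply: runs_assign; exists true; split=> // _.
  move: s3c; rewrite s3r => /esym/andP[/multipackingP mS kS].
  by exists (selected s2).
apply: runs_skip; exists b; split=> //=; first by rewrite ext3.2.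
move=> S cS mS kS; rewrite ltnS leq_eqVlt => /predU1P[Si|]; last exact: I1.
move: s3c; rewrite s3r (I2 S cS Si) kS andbT => /esym.
by have /multipackingP -> := mS.
Qed.

End Correctness.

(** * The two phases put together and the final time bound *)

Lemma bounded_preprocess : bounded_loops [:: 0] Preprocess.
Proof. by do ![split | eexists]. Qed.

Lemma bounded_enumerate : bounded_loops [:: 0; 2] Enumerate.
Proof. by do ![split | eexists]. Qed.

Lemma runs_preprocess (D : digraph) k :
  runs Preprocess (initial_state D k) (fun s =>
    [/\ indexed D s, ball_table D s & reg s 2 = 2 ^ #|@repr_twin D|]).
Proof.
apply: runs_seq; set s0 := initial_state D k.
apply: runs_conseq (@runs_row_table D s0 _ _ _) _ => // s1 fr1 s1I.
have sD1 : indexed D s1.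
  by split; [rewrite fr1.1|rewrite fr1.2|exact: s1I].
apply: runs_seq; apply: runs_conseq (runs_ball_table sD1) _ => s2 fr2 sB2.
have sD2 : indexed D s2 by apply: indexed_frame fr2 _ _ _ sD1.
apply: runs_conseq (runs_candidates sD2) _ => s3 fr3 s32.
split=> //; first by apply: indexed_frame fr3 _ _ _ sD2.
by move=> r v u rn; rewrite fr3.2 // sB2.
Qed.

Lemma runs_enumerate (D : digraph) s :
  indexed D s -> ball_table D s -> reg s 2 = 2 ^ #|@repr_twin D| ->
  reg s 8 = 0 -> arr s 5 0 = 0 -> arr s 6 0 = 0 ->
  runs Enumerate s (fun s' =>
    exists2 b : bool, reg s' 8 = b & b <-> Multipacking D (reg s 1)).
Proof.
move=> sD sB s2 s8 s5 s6; apply: runs_seq.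
apply: runs_conseq (runs_half_table s5 s6) _ => s1 fr1 ho.
have sD1 : indexed D s1 by apply: indexed_frame fr1 _ _ _ sD.
have sB1 : ball_table D s1 by move=> r v u rn; rewrite fr1.2 // sB.
have {}ho : half_odd s1 (reg s1 2) by rewrite fr1.1.
apply: runs_conseq (runs_search sD1 sB1 ho _) _; first by rewrite fr1.1.
rewrite !fr1.1 // => s' _ [b [s'b bD Db]]; exists b => //; split=> // -[S [mS kS]].
have [S' [mS' cS' SS']] := canonical_multipacking mS.
apply: (Db S') => //; first exact: leq_trans SS'.
have := code_ltn S' (enum (ordinal (dorder D))).
by rewrite enumT s2 cardE /enum_mem size_filter.
Qed.

(** Bounding a by 2 ^ a leaves the exponent a + j * 2 ^ c, which is at most (a + j) * 2 ^ c and so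
    below 2 ^ (c + (a + j)). *)
Lemma leq_double_exp a j c N :
  N <= 2 ^ 2 ^ c -> a * N ^ j <= 2 ^ 2 ^ (c + (a + j)).
Proof.
move=> Nc; apply: (@leq_trans (2 ^ a * (2 ^ 2 ^ c) ^ j)).
  apply: leq_mul; first exact/ltnW/ltn_expl.
  by case: j => // j; rewrite leq_exp2r.
rewrite -expnM -expnD leq_exp2l // expnD.
have : 0 < 2 ^ c by rewrite expn_gt0.
have : a + j < 2 ^ (a + j) by apply: ltn_expl.
nia.
Qed.

Theorem theorem22 :
  exists (p : program) (f : nat -> nat) (b : nat),
    bigO f id /\
    solves_Multipacking_in_time p
      (fun D => 2 ^ 2 ^ f (vertex_cover_number D) * dorder D ^ b).
Proof.
have [a [j time_le]] := time_bound_poly Multipacking_program.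
exists Multipacking_program, (fun c => c.*2.+1 + (a + j)), j; split.
  by exists (3 + (a + j)), 1 => m m0; rewrite /id; nia.
(* As n and N are positive, their product dominates both loop bounds, and M ^ j splits into the
   power of N absorbed by the double exponential and n ^ j. *)
move=> D k [n0 _]; set N := 2 ^ #|@repr_twin D|; pose M := N * dorder D.
have N0 : 0 < N by rewrite expn_gt0.
have [s1 [t1 [ex1 [sD1 sB1 s12]]]] := runs_preprocess D k.
have fr1 := exec_frame ex1.
have [||| s2 [t2 [ex2 [b s2b bD]]]] := runs_enumerate sD1 sB1 s12.
- by rewrite fr1.1.
- by rewrite fr1.2.
- by rewrite fr1.2.
exists (set_reg s2 0 b), (t1 + (t2 + 2)); split.
- apply: exec_Seq ex1 (exec_Seq ex2 _).
  by rewrite -s2b; apply: exec_Assign.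
- apply: (@leq_trans (a * M ^ j)); last first.
    rewrite expnMn mulnA leq_mul2r leq_double_exp ?orbT //.
    by rewrite leq_exp2l // card_repr_twin.
  apply: leq_trans (time_le M _); last by rewrite muln_gt0 N0.
  have s10 : reg s1 0 = dorder D by case: sD1.
  apply: leq_add.
    apply: exec_time_bound ex1 bounded_preprocess _ _ => //=.
    by rewrite andbT leq_pmull.
  apply: leq_add => //; apply: exec_time_bound ex2 bounded_enumerate _ _ => //=.
  by rewrite s10 s12 leq_pmull // leq_pmulr.
- by rewrite fr1.1 // in bD; move/bD => b1; rewrite /= b1.
- by rewrite fr1.1 // in bD => nD /=; case: b bD {s2b} => // -[/(_ isT)].
Qed.
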